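(* Let $\mathcal{A}$ be a generic arrangement of $n$ hyperplanes in $\mathbb{R}^k$, $k<n$, and let $X\in\mathcal{L}(\mathcal{B}(n,k,\mathcal{A}))$ be a minimal non-very generic intersection. Then $a_X\le\operatorname{rank}(X)+\ell_X-1$. In particular, $\operatorname{rank}(X)<a_X\le\operatorname{rank}(X)+k-1$.
   Context: A central arrangement $\mathcal{A}=\{H_1,\dots,H_n\}$ in $\mathbb{R}^k$ ($k<n$), with normals $\alpha_i$, is generic if any $m\le k$ of its hyperplanes intersect in codimension $m$. Identify $\mathbb{R}^n$ with the space of parallel translates via $t\mapsto(H_i+t_i\alpha_i)_i$. For $L\subset[n]$, $|L|=k+1$, $D_L=\{t\mid\bigcap_{i\in L}(H_i+t_i\alpha_i)\ne\emptyset\}$; $\mathcal{B}(n,k,\mathcal{A})=\{D_L\}$ is the discriminantal arrangement with intersection poset $\mathcal{L}(\mathcal{B}(n,k,\mathcal{A}))$. For $|S|\ge k+1$, $D_S=\bigcap_{L\subset S,|L|=k+1}D_L$. $D_S$ is a component of $X$ if $X\subset D_S$ and $X\not\subset D_{S\cup\{j\}}$ for all $j\notin S$; the canonical presentation $\{S_1,\dots,S_m\}$ of $X$ is the set of index sets of all its components. Athanasiadis rank $a_X=\sum_i(|S_i|-k)$; $\operatorname{rank}(X)$ is the codimension; $X$ is very generic if $\operatorname{rank}(X)=a_X$, non-very generic otherwise. A non-very generic $X$ is minimal if every $Y\in\mathcal{L}$ with $Y\supsetneq X$ is very generic. $\ell_X=\min_{j\in\bigcup_iS_i}|\{i\in[m]\mid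 j\in S_i\}|$. *)

(* Defs.v *)
From HB Require Import structures.
From mathcomp Require Import all_boot all_order all_algebra.
From mathcomp Require Import reals.

Set Implicit Arguments.
Unset Strict Implicit.
Unset Printing Implicit Defensive.

Import GRing.Theory.
Local Open Scope ring_scope.

(* An arrangement of n hyperplanes in R^k is given by its normals
   al : 'I_n -> 'rV[R]_k; the hyperplanes are the orthogonal complements. *)
Definition hyperplane (R : realType) (n k : nat) (al : 'I_n -> 'rV[R]_k)
    (i : 'I_n) : {vspace 'rV[R]_k} :=
  lker (linfun (mulmxr (al i)^T : 'rV[R]_k -> 'rV[R]_1)).

Lemma mem_hyperplane (R : realType) (n k : nat) (al : 'I_n -> 'rV[R]_k)
    (i : 'I_n) (x : 'rV[R]_k) :
  (x \in hyperplane al i) = (\sum_(j < k) x 0 j * al i 0 j == 0).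
Proof.
have e : (x *m (al i)^T) 0 0 = \sum_(j < k) x 0 j * al i 0 j.
  by rewrite mxE; apply: eq_bigr => j _; rewrite mxE.
rewrite memv_ker lfunE /= -e; apply/eqP/eqP => [->|h]; first by rewrite mxE.
by apply/matrixP => a b; rewrite !ord1 h mxE.
Qed.

Definition is_central_arrangement (R : realType) (n k : nat)
    (al : 'I_n -> 'rV[R]_k) : Prop :=
  forall i : 'I_n, al i != 0.

Definition codim (R : realType) (d : nat) (V : {vspace 'rV[R]_d}) : nat :=
  (d - \dim V)%N.

Definition is_generic (R : realType) (n k : nat) (al : 'I_n -> 'rV[R]_k) : Prop :=
  forall I : {set 'I_n}, (#|I| <= k)%N ->
    codim (\bigcap_(i in I) hyperplane al i)%VS = #|I|.

Definition untranslate (R : realType) (n k : nat) (al : 'I_n -> 'rV[R]_k)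
    (i : 'I_n) (p : 'rV[R]_k * 'rV[R]_n) : 'rV[R]_k :=
  p.1 - p.2 0 i *: al i.

Lemma untranslate_is_linear (R : realType) (n k : nat) (al : 'I_n -> 'rV[R]_k)
    (i : 'I_n) : linear (untranslate al i).
Proof.
move=> a p q; rewrite /untranslate /= !mxE scalerDl scalerBr scalerA opprD.
by rewrite addrACA.
Qed.

HB.instance Definition _ (R : realType) (n k : nat) (al : 'I_n -> 'rV[R]_k)
    (i : 'I_n) :=
  GRing.isLinear.Build R ('rV[R]_k * 'rV[R]_n)%type 'rV[R]_k *:%R
    (untranslate al i) (untranslate_is_linear al i).

(* D_L as a subspace of R^n: the projection to the t-coordinate of the set of
   pairs (x, t) with x in H_i + t_i al_i for all i in L (see mem_D). *)
Definition D (R : realType) (n k : nat) (al : 'I_n -> 'rV[R]_k)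
    (L : {set 'I_n}) : {vspace 'rV[R]_n} :=
  (linfun (@snd 'rV[R]_k 'rV[R]_n) @:
     \bigcap_(i in L) (linfun (untranslate al i) @^-1: hyperplane al i))%VS.

Lemma mem_D (R : realType) (n k : nat) (al : 'I_n -> 'rV[R]_k)
    (L : {set 'I_n}) (t : 'rV[R]_n) :
  reflect (exists x : 'rV[R]_k, forall i : 'I_n, i \in L ->
             exists2 h : 'rV[R]_k, h \in hyperplane al i & x = h + t 0 i *: al i)
          (t \in D al L).
Proof.
have capP (p : ('rV[R]_k * 'rV[R]_n)%type) : reflect
    (forall i, i \in L -> p.1 - p.2 0 i *: al i \in hyperplane al i)
    (p \in (\bigcap_(i in L) (linfun (untranslate al i) @^-1: hyperplane al i))%VS).
  apply: (iffP idP) => [hp i iL|hp].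
    have := subvP (bigcapv_inf i iL (subvv _)) _ hp.
    by rewrite -memv_preim lfunE.
  rewrite memvE; apply/subv_bigcapP => i iL.
  by rewrite -memvE -memv_preim lfunE; apply: hp.
apply: (iffP memv_imgP) => [[[x s] /capP hp ->]|[x hx]].
  exists x => i iL; exists (x - s 0 i *: al i); first exact: hp.
  by rewrite lfunE /= subrK.
exists (x, t); last by rewrite lfunE.
by apply/capP => i iL /=; have [h hh ->] := hx i iL; rewrite addrK.
Qed.

Definition in_intersection_poset (R : realType) (n k : nat)
    (al : 'I_n -> 'rV[R]_k) (X : {vspace 'rV[R]_n}) : Prop :=
  exists2 F : {set {set 'I_n}},
    (forall L, L \in F -> #|L| = k.+1) & X = (\bigcap_(L in F) D al L)%VS.

Definition DS (R : realType) (n k : nat) (al : 'I_n -> 'rV[R]_k)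
    (S : {set 'I_n}) : {vspace 'rV[R]_n} :=
  (\bigcap_(L : {set 'I_n} | (L \subset S) && (#|L| == k.+1)) D al L)%VS.

Definition is_component (R : realType) (n k : nat) (al : 'I_n -> 'rV[R]_k)
    (X : {vspace 'rV[R]_n}) (S : {set 'I_n}) : bool :=
  [&& (k.+1 <= #|S|)%N, (X <= DS al S)%VS &
      [forall j, (j \notin S) ==> ~~ (X <= DS al (j |: S))%VS]].

Definition canonical_presentation (R : realType) (n k : nat)
    (al : 'I_n -> 'rV[R]_k) (X : {vspace 'rV[R]_n}) : {set {set 'I_n}} :=
  [set S | is_component al X S].

Definition athanasiadis_rank (R : realType) (n k : nat)
    (al : 'I_n -> 'rV[R]_k) (X : {vspace 'rV[R]_n}) : nat :=
  (\sum_(S in canonical_presentation al X) (#|S| - k))%N.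

Definition very_generic (R : realType) (n k : nat) (al : 'I_n -> 'rV[R]_k)
    (X : {vspace 'rV[R]_n}) : Prop :=
  codim X = athanasiadis_rank al X.

Definition minimal_non_very_generic (R : realType) (n k : nat)
    (al : 'I_n -> 'rV[R]_k) (X : {vspace 'rV[R]_n}) : Prop :=
  ~ very_generic al X /\
  forall Y : {vspace 'rV[R]_n}, in_intersection_poset al Y ->
    (X <= Y)%VS -> Y <> X -> very_generic al Y.

(* The default value m = #|canonical_presentation al X| bounds every term, so
   this is the minimum over the union of the S_i as soon as it is nonempty. *)
Definition ell (R : realType) (n k : nat) (al : 'I_n -> 'rV[R]_k)
    (X : {vspace 'rV[R]_n}) : nat :=
  \big[minn/#|canonical_presentation al X|]_(j in cover (canonical_presentation al X))
     #|[set S in canonical_presentation al X | j \in S]|.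

(* Main.v *)
(** Fix j in the union of the components of X and delete it from every
component: the resulting Y_j strictly contains X, since it contains the
coordinate vector e_j, and its components are the sets S_i \ j having more
than k elements.  By minimality Y_j is very generic, so its codimension is
a_X - deg j, where deg j is the number of components containing j; strict
inclusion then gives a_X < rank X + deg j.

For l_X <= k, let N be the size of the union U of the components.  As X has
at least two components, two of which never share k elements, D_(U \ j) is
strictly smaller than Y_j, whence a_X <= N - 2 - k + l_X.  On the other hand
l_X N <= sum_j deg j = sum_i |S_i| <= (k + 1) a_X.  For l_X > k and N > k + 1
these two bounds are incompatible. *)

From HB Require Import structures.
Require Import Defs.
From mathcomp Require Import all_boot all_order all_algebra.
From mathcomp Require Import reals.
From mathcomp Require Import zify.

Set Implicit Arguments.
Unset Strict Implicit.
Unset Printing Implicit Defensive.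

Import Order.TTheory GRing.Theory Num.Theory.
Local Open Scope ring_scope.

(** * Preliminaries on inner products, subsets and minima *)

Definition dotr (R : realType) (k : nat) (a x : 'rV[R]_k) : R := (x *m a^T) 0 0.

Lemma dotrE (R : realType) (k : nat) (a x : 'rV[R]_k) :
  dotr a x = \sum_(j < k) x 0 j * a 0 j.
Proof. by rewrite /dotr mxE; apply: eq_bigr => j _; rewrite mxE. Qed.

Lemma dotr_linear (R : realType) (k : nat) (a : 'rV[R]_k) :
  linear_for *%R (dotr a).
Proof. by move=> c x y; rewrite /dotr mulmxDl -scalemxAl !mxE. Qed.

HB.instance Definition _ (R : realType) (k : nat) (a : 'rV[R]_k) :=
  GRing.isLinear.Build R 'rV[R]_k R *%R (dotr a) (dotr_linear a).

Lemma dotr_neq0 (R : realType) (k : nat) (a : 'rV[R]_k) :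
  a != 0 -> dotr a a != 0.
Proof.
apply: contra_neq; rewrite dotrE => /psumr_eq0P h.
apply/rowP => j; rewrite mxE; apply/eqP; rewrite -sqrf_eq0 expr2.
by rewrite h // => i _; rewrite -expr2 sqr_ge0.
Qed.

Lemma subset_of_card (T : finType) (A : {set T}) (m : nat) :
  (m <= #|A|)%N -> exists2 B : {set T}, B \subset A & #|B| = m.
Proof.
rewrite -bin_gt0 -cards_draws card_gt0 => /set0Pn[B].
by rewrite inE => /andP[? /eqP]; exists B.
Qed.

(** No value of [F] exceeds the default [m], so the default cannot lower the minimum, which is
    attained on the nonempty set [A]. *)
Lemma bigminn_attained (T : finType) (A : {set T}) (F : T -> nat) (m : nat) (j0 : T) :
  j0 \in A -> (forall j, (F j <= m)%N) ->
  exists2 j, j \in A &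
    \big[minn/m]_(i in A) F i = F j /\ forall i, i \in A -> (F j <= F i)%N.
Proof.
move=> Aj0 leFm; have [j Aj jmin] := @arg_minnP T j0 (fun j => j \in A) F Aj0; exists j => //; split=> //.
apply/eqP; rewrite eqn_leq; apply/andP; split; last first.
  by elim/big_ind: _ => // x y; rewrite leq_min => -> ->.
have: j \in index_enum T by rewrite mem_index_enum.
elim: (index_enum T) => // i s IH; rewrite inE big_cons.
case/predU1P => [<-|/IH le]; first by rewrite Aj geq_minl.
by case: ifP => // _; apply: leq_trans le; apply: geq_minr.
Qed.

(** * Membership in D_S and spans of coordinate vectors *)

Section Discriminantal.
Variables (R : realType) (n k : nat) (al : 'I_n -> 'rV[R]_k).
Implicit Types (S T K L U : {set 'I_n}) (X Y V : {vspace 'rV[R]_n}).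

Local Notation unit_row i := (delta_mx 0 i : 'rV[R]_n).

(** Pairing with the normal kills the part of a point lying in H_i, so each translate becomes one
    scalar equation. *)
Lemma D_dotrP S (t : 'rV[R]_n) :
  reflect (exists x, forall i, i \in S ->
             dotr (al i) x = t 0 i * dotr (al i) (al i))
          (t \in D al S).
Proof.
apply: (iffP (mem_D al S t)) => -[x hx]; exists x => i iS.
  have [h] := hx i iS; rewrite mem_hyperplane -dotrE => /eqP h0 ->.
  by rewrite raddfD /= h0 add0r linearZ.
exists (x - t 0 i *: al i); last by rewrite subrK.
by rewrite mem_hyperplane -dotrE raddfB /= linearZ /= hx // subrr.
Qed.

Lemma D_anti S T : S \subset T -> (D al T <= D al S)%VS.
Proof.
move=> /subsetP sST; apply/subvP => t /D_dotrP[x hx].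
by apply/D_dotrP; exists x => i /sST/hx.
Qed.

(** Moving H_j alone leaves the origin on every hyperplane indexed by [S]. *)
Lemma D_unit_row S j : j \notin S -> unit_row j \in D al S.
Proof.
move=> jS; apply/D_dotrP; exists 0 => i iS; rewrite raddf0 mxE eqxx /=.
by case: eqVneq iS jS => [->->|] //; rewrite mul0r.
Qed.

Lemma mem_span_unit_row (s : seq 'I_n) (t : 'rV[R]_n) :
  (t \in <<[seq unit_row i | i <- s]>>%VS) = [forall i, (i \notin s) ==> (t 0 i == 0)].
Proof.
apply/idP/forall_inP => [/(@coord_span _ _ _ (in_tuple _)) -> i ins|t0].
  rewrite summxE big1 // => l _; rewrite mxE.
  have ls : (l < size s)%N by rewrite -(size_map (fun j => unit_row j)) ltn_ord.
  rewrite (nth_map i) // mxE eqxx /=; case: eqVneq => [e|]; last by rewrite mulr0.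
  by case/negP: ins; rewrite e mem_nth.
rewrite [t]row_sum_delta; apply: memv_suml => i _.
have [/t0/eqP->|/negbNE is_] := boolP (i \notin s); first by rewrite scale0r mem0v.
by apply/memvZ/memv_span/map_f.
Qed.

Lemma dim_span_unit_row (s : seq 'I_n) :
  uniq s -> \dim <<[seq unit_row i | i <- s]>> = size s.
Proof.
move=> us; rewrite -[RHS](size_map (fun i => unit_row i)); apply/eqP.
rewrite -/(free _); elim: s us => [|i s IH] /=; first by rewrite nil_free.
case/andP=> ins us; rewrite free_cons IH // andbT mem_span_unit_row.
apply/forall_inP => /(_ i ins).
by rewrite mxE !eqxx oner_eq0.
Qed.

(** * Consequences of genericity: uniqueness of common points and the codimension of D_S *)

Hypothesis central : is_central_arrangement al.
Hypothesis generic : is_generic al.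

Let q_neq0 i : dotr (al i) (al i) != 0.
Proof. exact: dotr_neq0. Qed.

(** Already [k] of the hyperplanes indexed by [S] meet in codimension [k], that is, only at the
    origin. *)
Lemma dotr_generic_eq0 S (x : 'rV[R]_k) : (k <= #|S|)%N ->
  (forall i, i \in S -> dotr (al i) x = 0) -> x = 0.
Proof.
move=> kS h.
have [K /subsetP KS cK] : exists2 K : {set 'I_n}, K \subset S & #|K| = k.
  exact: subset_of_card.
have := generic (eq_leq cK); rewrite /codim cK => cd.
set V := (\bigcap_(i in K) _)%VS in cd.
have xV : x \in V.
  rewrite memvE; apply/subv_bigcapP => i iK.
  by rewrite -memvE mem_hyperplane -dotrE h ?KS.
have dV : \dim V = 0%N.
  have := dimvS (subvf V); rewrite dimvf /dim /= mul1n; lia.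
by move/eqP: dV xV; rewrite dimv_eq0 => /eqP ->; rewrite memv0 => /eqP.
Qed.

Lemma dotr_generic_inj S (x y : 'rV[R]_k) : (k <= #|S|)%N ->
  (forall i, i \in S -> dotr (al i) x = dotr (al i) y) -> x = y.
Proof.
move=> kS h; apply/eqP; rewrite -subr_eq0; apply/eqP.
by apply: (dotr_generic_eq0 kS) => i iS; rewrite raddfB /= h // subrr.
Qed.

(** A common point of [k] translates is unique, so the points witnessing the two memberships
    coincide. *)
Lemma D_setU S T (t : 'rV[R]_n) : (k <= #|S :&: T|)%N ->
  t \in D al S -> t \in D al T -> t \in D al (S :|: T).
Proof.
move=> kST /D_dotrP[x hx] /D_dotrP[y hy]; apply/D_dotrP; exists x => i.
have yx : y = x by apply: (dotr_generic_inj kST) => j /setIP[jS jT]; rewrite hx ?hy.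
by rewrite yx in hy; case/setUP; [apply: hx|apply: hy].
Qed.

(** The hyperplanes of [S :\ j], at least [k] in number, are unmoved and meet only at the origin,
    which the shifted H_j misses. *)
Lemma D_unit_rowN S j : (k < #|S|)%N -> j \in S -> unit_row j \notin D al S.
Proof.
move=> kS jS; apply/negP => /D_dotrP[x hx].
have x0 : x = 0.
  apply: (@dotr_generic_eq0 (S :\ j)); first by rewrite (cardsD1 j) jS in kS.
  by move=> i /setD1P[ij /hx ->]; rewrite mxE (negPf ij) andbF mul0r.
by have /eqP := hx j jS; rewrite x0 raddf0 mxE !eqxx mul1r eq_sym (negPf (q_neq0 j)).
Qed.

(** Fix [k] indices [K] in [S]. The translates indexed by [K] share at most one point, so the common
    points found for the sets [i |: K] all agree and serve the whole of [S]. *)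
Lemma DS_D S : (k < #|S|)%N -> DS al S = D al S.
Proof.
move=> kS; apply/eqP; rewrite eqEsubv; apply/andP; split; last first.
  by apply/subv_bigcapP => L /andP[LS _]; apply: D_anti.
have [K KS cK] : exists2 K : {set 'I_n}, K \subset S & #|K| = k.
  exact: subset_of_card (ltnW kS).
apply/subvP => t tDS.
have tK i : i \in S -> i \notin K -> t \in D al (i |: K).
  move=> iS iK; apply: subvP tDS; apply: (bigcapv_inf (i |: K) _ (subvv _)).
  by rewrite subUset sub1set iS KS cardsU1 iK cK eqxx.
have [i0 i0S i0K] : exists2 i, i \in S & i \notin K.
  by apply/subsetPn; apply/negP => /subset_leq_card; rewrite cK leqNgt kS.
have /D_dotrP[x hx] := tK i0 i0S i0K; apply/D_dotrP; exists x => i iS.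
have [iK|iK] := boolP (i \in K); first by apply: hx; rewrite setU1r.
have /D_dotrP[y hy] := tK i iS iK.
have -> : x = y; last by apply: hy; rewrite setU11.
by apply: (@dotr_generic_inj K) => [|l lK]; rewrite ?cK // hx ?hy // setU1r.
Qed.

(* D_S is the direct sum of the translations [g x] of the whole arrangement to a
   common point x and of the coordinate directions outside S. *)
Lemma codim_D S : (k <= #|S|)%N -> codim (D al S) = (#|S| - k)%N.
Proof.
move=> kS.
pose g (x : 'rV[R]_k) : 'rV[R]_n := \row_i (dotr (al i) x / dotr (al i) (al i)).
have g_lin : linear g.
  by move=> c x y; apply/rowP => i; rewrite !mxE linearP /= mulrDl mulrA.
pose gL : {linear 'rV[R]_k -> 'rV[R]_n} :=
  HB.pack g (GRing.isLinear.Build R 'rV[R]_k 'rV[R]_n *:%R g g_lin).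
pose A := limg (linfun gL).
pose B := <<[seq unit_row i | i <- enum (~: S)]>>%VS.
have gE x : linfun gL x = g x by rewrite lfunE.
(* As [S] has at least [k] indices, the coordinates in [S] determine x; this gives both the
   directness of the sum and the injectivity of [g]. *)
have g0 x : (forall i, i \in S -> g x 0 i = 0) -> x = 0.
  move=> h; apply: (dotr_generic_eq0 kS) => i /h/eqP.
  by rewrite mxE mulf_eq0 invr_eq0 (negPf (q_neq0 i)) orbF => /eqP.
have BE t : (t \in B) = [forall i in S, t 0 i == 0].
  rewrite mem_span_unit_row; apply: eq_forallb => i.
  by rewrite mem_enum inE negbK.
have DAB : D al S = (A + B)%VS.
  apply/vspaceP => t; apply/D_dotrP/memv_addP => [[x hx]|[a aA [b bB ->]]].
    exists (g x); first by rewrite -gE memv_img ?memvf.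
    exists (t - g x); last by rewrite addrC subrK.
    rewrite BE; apply/forall_inP => i iS.
    by rewrite !mxE hx // mulfK // subrr.
  case/memv_imgP: aA => x _ ->; exists x => i iS; move: bB; rewrite BE.
  by move/forall_inP/(_ i iS)/eqP; rewrite gE !mxE => ->; rewrite addr0 divfK.
have AB0 : (A :&: B = 0)%VS.
  apply/eqP; rewrite -subv0; apply/subvP => t /memv_capP[/memv_imgP[x _ ->]].
  rewrite gE BE => /forall_inP h; rewrite (g0 x) ?memv0 => [|i /h/eqP //].
  by rewrite -gE linear0.
have ker0 : (fullv :&: lker (linfun gL) = 0)%VS.
  apply/eqP; rewrite -subv0; apply/subvP => x /memv_capP[_].
  rewrite memv_ker gE => /eqP gx0; rewrite memv0; apply/eqP/g0 => i _.
  by rewrite gx0 mxE.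
rewrite /codim DAB dimv_disjoint_sum // limg_dim_eq // dim_span_unit_row ?enum_uniq //.
rewrite dimvf /dim /= mul1n -cardE.
have hn := cardsC S; rewrite card_ord in hn; rewrite -[X in (X - _)%N = _]hn.
exact: subnDr.
Qed.

(** * Components of an intersection *)

Local Notation CP := (canonical_presentation al).

Lemma componentP X S : reflect
  [/\ (k < #|S|)%N, (X <= D al S)%VS & forall j, j \notin S -> ~~ (X <= D al (j |: S))%VS]
  (S \in CP X).
Proof.
rewrite inE /is_component; have [kS|] := ltnP k #|S|; last first.
  by move=> _; constructor => -[].
have kS1 j : (k < #|j |: S|)%N by apply/(leq_trans kS)/subset_leq_card/subsetUr.
rewrite DS_D //=; apply: (iffP andP) => [[XS /forall_inP h]|[_ XS h]]; split=> //.
  by move=> j /h; rewrite DS_D.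
by apply/forall_inP => j /h; rewrite DS_D.
Qed.

(** A set containing [T] that is maximal among those with these two properties is a component. *)
Lemma sub_component X T : (k < #|T|)%N -> (X <= D al T)%VS ->
  exists2 S, S \in CP X & T \subset S.
Proof.
move=> kT XT; pose P S := (k < #|S|)%N && (X <= D al S)%VS.
have [|S /maxsetP[/andP[kS XS] Smax] TS] := @maxset_exists _ P T; first exact/andP.
exists S => //; apply/componentP; split=> // j jS; apply/negP => XjS.
case/negP: jS; rewrite -(Smax (j |: S)) ?setU11 ?subsetUr //.
by rewrite /P XjS andbT; apply/(leq_trans kS)/subset_leq_card/subsetUr.
Qed.

(** By [D_setU], [X] lies in [D al (S :|: T)], so the maximality of [S] leaves no index of [T]
    outside it. *)
Lemma component_absorb X S T : S \in CP X -> (X <= D al T)%VS ->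
  (k <= #|S :&: T|)%N -> T \subset S.
Proof.
move=> /componentP[kS XS Smax] XT kST; apply/subsetP => j jT.
apply: contraT => /Smax/negP[].
have XST : (X <= D al (S :|: T))%VS.
  by apply/subvP => t tX; apply: D_setU => //; apply: subvP tX.
by apply: subv_trans XST _; apply: D_anti; rewrite setUC setUS // sub1set.
Qed.

Lemma component_eq X S T : S \in CP X -> T \in CP X -> (k <= #|S :&: T|)%N -> S = T.
Proof.
move=> SX TX kST; have /componentP[_ XS _] := SX; have /componentP[_ XT _] := TX.
apply/eqP; rewrite eqEsubset (component_absorb TX) ?(component_absorb SX) //.
by rewrite setIC.
Qed.

(** Each generating set [L] lies in some component [S], and then D_S lies in D_L. *)
Lemma bigcap_components X : in_intersection_poset al X ->
  X = (\bigcap_(S in CP X) D al S)%VS.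
Proof.
case=> F cF XF; apply/eqP; rewrite eqEsubv; apply/andP; split.
  by apply/subv_bigcapP => S /componentP[].
rewrite [Z in (_ <= Z)%VS]XF; apply/subv_bigcapP => L LF.
have [||S SX LS] := @sub_component X L; first by rewrite cF.
  by rewrite XF; apply: bigcapv_inf (subvv _).
by apply: bigcapv_inf SX _; apply: D_anti.
Qed.

(** * Codimension against Athanasiadis rank *)

Lemma codim_capv V W : (codim (V :&: W)%VS <= codim V + codim W)%N.
Proof.
have := dimv_sum_cap V W; have := dimvS (subvf (V + W)%VS).
have := dimvS (subvf V); have := dimvS (subvf W).
rewrite /codim dimvf /dim /= mul1n; lia.
Qed.

Lemma codim_le_athanasiadis_rank X : in_intersection_poset al X ->
  (codim X <= athanasiadis_rank al X)%N.
Proof.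
move=> /bigcap_components XE; rewrite /athanasiadis_rank {1}XE.
apply: leq_trans (_ : (\sum_(S in CP X) codim (D al S) <= _)%N).
  elim/big_rec2: _ => [|S m V _ IH]; first by rewrite /codim dimvf /dim /= mul1n subnn.
  by apply: leq_trans (codim_capv _ _) _; rewrite leq_add2l.
by apply: leq_sum => S /componentP[/ltnW kS _ _]; rewrite codim_D.
Qed.

(** * Deletion of an index from all components *)

(* The space Y_j of the header. *)
Definition avoiding X (j : 'I_n) : {vspace 'rV[R]_n} :=
  (\bigcap_(L in [set L : {set 'I_n} | (#|L| == k.+1) &&
       [exists S in CP X, L \subset S :\ j]]) D al L)%VS.

Lemma avoiding_poset X j : in_intersection_poset al (avoiding X j).
Proof. by eexists=> [L|//]; rewrite inE => /andP[/eqP]. Qed.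

Lemma sub_avoiding X j : (X <= avoiding X j)%VS.
Proof.
apply/subv_bigcapP => L; rewrite inE => /andP[_ /exists_inP[S]].
case/componentP=> _ XS _ LS; apply: subv_trans XS _; apply: D_anti.
exact: subset_trans LS (subsetDl _ _).
Qed.

Lemma unit_row_avoiding X j : unit_row j \in avoiding X j.
Proof.
rewrite memvE; apply/subv_bigcapP => L; rewrite inE => /andP[_ /exists_inP[S _ LS]].
rewrite -memvE; apply: D_unit_row.
by apply/negP => /(subsetP LS); rewrite !inE eqxx.
Qed.

Lemma avoiding_sub X j S T : S \in CP X -> T \subset S :\ j -> (k < #|T|)%N ->
  (avoiding X j <= D al T)%VS.
Proof.
move=> SX TS kT; rewrite -DS_D //; apply/subv_bigcapP => L /andP[LT cL].
apply: bigcapv_inf (subvv _); rewrite inE cL; apply/exists_inP; exists S => //.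
exact: subset_trans TS.
Qed.

Lemma avoiding_neq X j : j \in cover (CP X) -> avoiding X j <> X.
Proof.
move=> /bigcupP[S /componentP[kS XS _] jS] eX.
have := unit_row_avoiding X j; rewrite eX => /(subvP XS).
by rewrite (negPf (D_unit_rowN kS jS)).
Qed.

(** Components of Y_j avoid [j] because e_j lies in Y_j. Absorption of sets sharing [k] indices,
    used in Y_j for one inclusion and in [X] for the other, then forces equality. *)
Lemma avoiding_components X j :
  CP (avoiding X j) =
  [set S :\ j | S in [set S in CP X | (k < #|S :\ j|)%N]].
Proof.
apply/setP => T; apply/idP/imsetP => [TY|[S]].
  have /componentP[kT YT _] := TY.
  have [//||S SX TS] := @sub_component X T.
    exact: subv_trans (sub_avoiding X j) YT.
  have TSj : T \subset S :\ j.
    rewrite subsetD1 TS; apply/negP => jT.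
    have := subvP YT _ (unit_row_avoiding X j).
    by rewrite (negPf (D_unit_rowN kT jT)).
  have kSj := leq_trans kT (subset_leq_card TSj).
  exists S; first by rewrite inE SX.
  apply/eqP; rewrite eqEsubset TSj; apply: (component_absorb TY).
    exact: avoiding_sub SX _ _.
  by rewrite (setIidPl TSj) ltnW.
rewrite inE => /andP[SX kSj] ->; have /componentP[kS XS Smax] := SX.
have YSj : (avoiding X j <= D al (S :\ j))%VS by exact: avoiding_sub SX _ _.
have [W WY SW] := sub_component kSj YSj.
suff -> : S :\ j = W by [].
have /componentP[kW YW _] := WY.
apply/eqP; rewrite eqEsubset SW subsetD1 /=; apply/andP; split.
  apply: (component_absorb SX); first exact: subv_trans (sub_avoiding X j) YW.
  apply: leq_trans (ltnW kSj) _; apply: subset_leq_card.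
  by rewrite subsetI SW subsetDl.
apply/negP => jW; have := subvP YW _ (unit_row_avoiding X j).
by rewrite (negPf (D_unit_rowN kW jW)).
Qed.

(** Deleting [j] lowers |S| - k by one for each component containing it; if |S| = k + 1, the set
    drops out and takes its term 1 with it. *)
Lemma athanasiadis_rank_avoiding X j :
  (athanasiadis_rank al (avoiding X j) + #|[set S in CP X | j \in S]| =
   athanasiadis_rank al X)%N.
Proof.
rewrite /athanasiadis_rank avoiding_components big_imset /=; last first.
  (* Deletion is injective here: two components with the same remainder share more than [k]
     indices. *)
  move=> S T; rewrite !inE => /andP[SX kS] /andP[TX _] eST.
  apply: (@component_eq X); rewrite ?inE //; apply: leq_trans (ltnW kS) _.
  by apply: subset_leq_card; rewrite subsetI subsetDl eST subsetDl.
under eq_bigl => S do rewrite inE.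
rewrite -sum1_card; under [X in (_ + X)%N]eq_bigl => S do rewrite inE.
rewrite !big_mkcondr -big_split; apply: eq_bigr => S /componentP[kS _ _] /=.
move: kS; rewrite (cardsD1 j S).
by move: #|S :\ j| => m; case: (j \in S) => /=; case: (ltnP k m); lia.
Qed.

Lemma codim_lt V W : (V <= W)%VS -> W <> V -> (codim W < codim V)%N.
Proof.
move=> VW WV; have := dimvS (subvf W); have := dimv_leqif_eq VW.
case=> + /esym; case: eqVneq => [/esym//|_] le_dim ne_dim.
by rewrite /codim dimvf /dim /= mul1n; lia.
Qed.

(** * Bounds for a minimal non-very generic intersection *)

Section MinimalNonVeryGeneric.
Variable X : {vspace 'rV[R]_n}.
Hypothesis poset : in_intersection_poset al X.
Hypothesis minimal : minimal_non_very_generic al X.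

Lemma codim_avoiding j : j \in cover (CP X) ->
  (codim (avoiding X j) + #|[set S in CP X | j \in S]| = athanasiadis_rank al X)%N.
Proof.
move=> jX; rewrite -(athanasiadis_rank_avoiding X j); congr (_ + _)%N.
by apply: minimal.2; [apply: avoiding_poset|apply: sub_avoiding|apply: avoiding_neq].
Qed.

Lemma athanasiadis_rank_lt j : j \in cover (CP X) ->
  (athanasiadis_rank al X < codim X + #|[set S in CP X | j \in S]|)%N.
Proof.
move=> jX; rewrite -(codim_avoiding jX) ltn_add2r.
by apply: codim_lt; [apply: sub_avoiding|apply: avoiding_neq].
Qed.

(** With a single component, [X] is D_S of codimension |S| - k; with none, it is the whole space.
    Both are very generic. *)
Lemma two_components : (1 < #|CP X|)%N.
Proof.
rewrite ltnNge leq_eqVlt ltnS leqn0; apply/negP => m1; apply: minimal.1.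
rewrite /very_generic /athanasiadis_rank {1}(bigcap_components poset).
case/orP: m1 => [/cards1P[S CPS]|]; last first.
  by rewrite cards_eq0 => /eqP->; rewrite !big_set0 /codim dimvf /dim /= mul1n subnn.
rewrite CPS !big_set1 codim_D //.
have : S \in CP X by rewrite CPS set11.
by case/componentP => /ltnW.
Qed.

(** Inside a union of at most k + 1 indices, every component would be the whole union, against there
    being two. *)
Lemma card_cover_gt : (k.+1 < #|cover (CP X)|)%N.
Proof.
have /card_gt1P[S [T [SX TX ST]]] := two_components.
have /componentP[kS _ _] := SX; have /componentP[kT _ _] := TX.
have SU : S \subset cover (CP X) by exact: bigcup_sup.
have TU : T \subset cover (CP X) by exact: bigcup_sup.
rewrite ltnNge; apply: contra_neqN ST => Uk.
have eqU (A : {set 'I_n}) : A \subset cover (CP X) -> (k < #|A|)%N -> A = cover (CP X).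
  by move=> AU kA; apply/eqP; rewrite eqEcard AU (leq_trans Uk).
by rewrite (eqU S SU kS) -(eqU T TU kT).
Qed.

Lemma codim_avoiding_lt j : j \in cover (CP X) ->
  (codim (avoiding X j) < #|cover (CP X)|.-1 - k)%N.
Proof.
move=> jX; set U := cover (CP X).
have cU : #|U :\ j| = #|U|.-1 by rewrite (cardsD1 j U) jX.
have kU : (k < #|U :\ j|)%N by have := card_cover_gt; rewrite cU -/U; lia.
rewrite -cU -codim_D ?(ltnW kU) //; apply: codim_lt.
  apply/subv_bigcapP => L; rewrite inE => /andP[_ /exists_inP[S SX LS]].
  apply: D_anti; apply: subset_trans LS _; apply: setSD; exact: bigcup_sup.
(* Under equality, U \ j would lie in one component [S]. Every component [T] would share with [S]
   the indices of T \ j, at least [k] of them, so all components would equal [S]. *)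
move=> eY; have XU : (X <= D al (U :\ j))%VS by rewrite -eY sub_avoiding.
have [S SX US] := sub_component kU XU.
have /card_gt1P[S1 [S2 [S1X S2X S12]]] := two_components.
suff eqS T : T \in CP X -> T = S by rewrite (eqS S1) // (eqS S2) // eqxx in S12.
move=> TX; apply: (component_eq TX SX); have /componentP[kT _ _] := TX.
have TU : T :\ j \subset S by apply: subset_trans US; apply: setSD; apply: bigcup_sup.
apply: leq_trans (_ : (#|T :\ j| <= _)%N); first by move: kT; rewrite (cardsD1 j T); lia.
by apply: subset_leq_card; rewrite subsetI subsetDl.
Qed.

(** Double counting turns the degrees into the sum of the |S|, and |S| <= (k + 1) (|S| - k) whenever
    |S| > k. *)
Lemma sum_degree :
  (\sum_(j in cover (CP X)) #|[set S in CP X | j \in S]| <= k.+1 * athanasiadis_rank al X)%N.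
Proof.
rewrite /athanasiadis_rank big_distrr /=.
apply: leq_trans (_ : (\sum_(S in CP X) #|S| <= _)%N); last first.
  apply: leq_sum => S /componentP[kS _ _]; move: kS; move: #|S| => m km; nia.
under eq_bigr => j _ do rewrite -sum1dep_card.
under [leqRHS]eq_bigr => S _ do rewrite -sum1_card.
rewrite (exchange_big_dep (mem (CP X))) /=; last by move=> i S _ /andP[].
apply: leq_sum => S SX; rewrite big_mkcond [leqRHS]big_mkcond.
by apply: leq_sum => j _; case: (j \in S); rewrite ?andbF //; case: ifP.
Qed.

Lemma ell_degree : exists2 j, j \in cover (CP X) &
  ell al X = #|[set S in CP X | j \in S]| /\
  forall i, i \in cover (CP X) -> (ell al X <= #|[set S in CP X | i \in S]|)%N.
Proof.
have /card_gt0P[j0 j0U] : (0 < #|cover (CP X)|)%N by have := card_cover_gt; lia.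
have [|j jU [e jmin]] := bigminn_attained (F := fun j => #|[set S in CP X | j \in S]|)
  (m := #|CP X|) j0U.
  by move=> j; apply: subset_leq_card; apply/subsetP => S; rewrite inE => /andP[].
by exists j => //; split=> // i /jmin; rewrite /ell e.
Qed.

Lemma ell_le : (ell al X <= k)%N.
Proof.
have [j jU [ej jmin]] := ell_degree.
have lN : (ell al X * #|cover (CP X)| <= k.+1 * athanasiadis_rank al X)%N.
  apply: leq_trans sum_degree; rewrite mulnC -sum_nat_const.
  exact: leq_sum.
have := codim_avoiding jU; rewrite -ej; have := codim_avoiding_lt jU.
have := card_cover_gt; move: lN; move: #|cover _| (codim _) (ell _ _) (athanasiadis_rank _ _).
(* From a = c + l, c <= N - 2 - k and l N <= (k + 1) a follows (l - k - 1) (N - k - 1) <= -(k + 1),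
   impossible if l > k and N > k + 1. *)
move=> N c l a; nia.
Qed.

End MinimalNonVeryGeneric.
End Discriminantal.

Theorem theorem4p11 (R : realType) (n k : nat) (al : 'I_n -> 'rV[R]_k)
    (X : {vspace 'rV[R]_n}) :
  (k < n)%N ->
  is_central_arrangement al ->
  is_generic al ->
  in_intersection_poset al X ->
  minimal_non_very_generic al X ->
  (athanasiadis_rank al X <= codim X + ell al X - 1)%N /\
  (codim X < athanasiadis_rank al X <= codim X + k - 1)%N.
Proof.
move=> _ central generic poset minimal.
(* An index of least degree makes the strict bound sharpest. *)
have [j jU [ej _]] := ell_degree central generic poset minimal.
have := athanasiadis_rank_lt central generic minimal jU; rewrite -ej.
have := ell_le central generic poset minimal.
(* Excluding equality makes the general bound of the codimension by a_X strict. *)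
have : codim X <> athanasiadis_rank al X by exact: minimal.1.
have := codim_le_athanasiadis_rank central generic poset.
lia.
Qed.
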